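(* There exists an Arnoux-Rauzy word $w$ whose Rauzy fractal $\mathcal{R}_w \subset \Delta_0$ is unbounded in all directions of the plane $\Delta_0$.
   Context: Let $A=\{1,2,3\}$, let $A^*$ be the set of finite words over $A$ and $A^{\mathbb{N}}$ the set of infinite words ($\mathbb{N}=\{0,1,2,\dots\}$). A finite word $u=u[0]\cdots u[n-1]$ is a factor of a (finite or infinite) word $w$ if there is $i\ge 0$ with $w[i+k]=u[k]$ for all $0\le k\le n-1$; if one can take $i=0$, $u$ is the prefix of length $n$ of $w$, denoted $p_n(w)$. Arnoux-Rauzy words. For $i\in A$ the Arnoux-Rauzy substitution $\sigma_i: A\to A^*$ is $\sigma_i(i)=i$, $\sigma_i(j)=ij$ for $j\in A\setminus\{i\}$, extended to a morphism for concatenation on $A^*$ and on $A^{\mathbb{N}}$. A sequence of finite words $(u_n)$ converges to an infinite word $w$ if for every sequence $(v_n)$ of infinite words, $u_n\cdot v_n$ converges to $w$ for the distance $\delta(x,y)=2^{-\min\{n: x[n]\ne y[n]\}}$ (and $\delta(x,x)=0$). If $(s_n)_{n\in\mathbb{N}}\in\{\sigma_1,\sigma_2,\sigma_3\}^{\mathbb{N}}$ contains infinitely many occurrences of each of $\sigma_1,\sigma_2,\sigma_3$, then for $\alpha\in A$ the sequence of finite words $s_0\circ\cdots\circ s_{n-1}(\alpha)$ converges to an infinite word $w_0$ not depending on $\alpha$; the words $w_0$ so obtained are the standard Arnoux-Rauzy words. An infinite word over $A$ is an Arnoux-Rauzy word if it has the same set of factors as some standard Arnoux-Rauzy word. Rauzy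 fractal. For a finite word $u$, $\mathrm{ab}(u)=(|u|_1,|u|_2,|u|_3)\in\mathbb{Z}^3$, where $|u|_\alpha$ is the number of occurrences of $\alpha$ in $u$. Every Arnoux-Rauzy word $w$ has a vector of letter frequencies $f_w=(f_w(\alpha))_{\alpha\in A}$, $f_w(\alpha)=\lim_{n\to\infty}|p_n(w)|_\alpha/n$. Let $\Delta_0$ be the plane $x+y+z=0$ in $\mathbb{R}^3$ and $\pi_w:\mathbb{R}^3\to\Delta_0$ the projection onto $\Delta_0$ parallel to $f_w$, i.e. associated with the direct sum $\mathbb{R}f_w\oplus\Delta_0=\mathbb{R}^3$. The Rauzy fractal of $w$ is the closure $\mathcal{R}_w=\overline{\bigcup_{k\in\mathbb{N}}\{\pi_w(\mathrm{ab}(p_k(w)))\}}\subset\Delta_0$. ''Unbounded in all directions of the plane'' means that $\mathcal{R}_w$ is not contained in the region between any two parallel lines of $\Delta_0$ (it is contained in no strip of $\Delta_0$). *)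

(* Defs.v *)
From mathcomp Require Import all_boot all_order all_algebra.
From mathcomp Require Import all_classical all_reals all_analysis.

Set Implicit Arguments.
Unset Strict Implicit.
Unset Printing Implicit Defensive.

Import Order.TTheory GRing.Theory Num.Theory.
Import numFieldNormedType.Exports.

Local Open Scope classical_set_scope.
Local Open Scope ring_scope.

(* The alphabet {1, 2, 3} is encoded as {0, 1, 2}. *)
Definition letter := 'I_3.
Definition word := seq letter.
Definition iword := nat -> letter.

Definition iprefix (w : iword) (n : nat) : word := mkseq w n.

Definition ifactor (u : word) (w : iword) : Prop :=
  exists i : nat, forall k : nat, (k < size u)%N -> w (i + k)%N = nth ord0 u k.

Definition cat_iword (u : word) (v : iword) : iword :=
  fun n => if (n < size u)%N then nth ord0 u n else v (n - size u)%N.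

Definition ar_letter (i j : letter) : word :=
  if j == i then [:: i] else [:: i; j].

Definition ar_subst (i : letter) (u : word) : word :=
  flatten (map (ar_letter i) u).

(* s_0 o ... o s_(n-1) (a), where s_k is the substitution of index d k. *)
Definition ar_iter (d : nat -> letter) (n : nat) (a : letter) : word :=
  foldr ar_subst [:: a] (mkseq d n).

Definition iword_dist (R : realType) (x y : iword) : R :=
  if pselect (exists n, x n != y n) is left neq_xy
  then 2 ^- ex_minn neq_xy else 0.

Definition words_cvg (R : realType) (u : nat -> word) (w : iword) : Prop :=
  forall v : nat -> iword,
    (fun n => iword_dist R (cat_iword (u n) (v n)) w) @ \oo --> (0 : R).

Definition standard_arnoux_rauzy (R : realType) (w : iword) : Prop :=
  exists d : nat -> letter,
    (forall i : letter, infinite_set [set n | d n = i]) /\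
    (forall a : letter, words_cvg R (fun n => ar_iter d n a) w).

Definition arnoux_rauzy (R : realType) (w : iword) : Prop :=
  exists w0 : iword, standard_arnoux_rauzy R w0 /\
    (forall u : word, ifactor u w <-> ifactor u w0).

Definition ab (R : realType) (u : word) : 'rV[R]_3 :=
  \row_a (count_mem a u)%:R.

Definition letter_ratio (R : realType) (w : iword) (a : letter) : nat -> R :=
  fun n => (count_mem a (iprefix w n))%:R / n%:R.

Definition has_letter_freq (R : realType) (w : iword) : Prop :=
  forall a : letter, cvgn (letter_ratio R w a).

(* Meaningful only under [has_letter_freq R w], as [limn] is total. *)
Definition letter_freq (R : realType) (w : iword) : 'rV[R]_3 :=
  \row_a limn (letter_ratio R w a).

(* The plane x + y + z = 0, as a row space: see [Delta0P]. *)
Definition Delta0 (R : realType) : 'M[R]_3 := kermx (const_mx 1 : 'cV[R]_3).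

Lemma Delta0P (R : realType) (x : 'rV[R]_3) :
  (x <= Delta0 R)%MS <-> \sum_i x 0 i = 0.
Proof.
have E : (x *m (const_mx 1 : 'cV[R]_3)) 0 0 = \sum_i x 0 i.
  by rewrite mxE; apply: eq_bigr => i _; rewrite mxE mulr1.
split=> [/sub_kermxP x0 | x0]; first by rewrite -E x0 mxE.
by apply/sub_kermxP/matrixP => i j; rewrite !ord1 E x0 mxE.
Qed.

(* The projection onto the plane [Delta0] parallel to the line spanned by
   the frequency vector of [w]. *)
Definition rauzy_proj (R : realType) (w : iword) (x : 'rV[R]_3) : 'rV[R]_3 :=
  x *m proj_mx (Delta0 R) <<letter_freq R w>>%MS.

Definition rauzy_fractal (R : realType) (w : iword) : set 'rV[R]_3 :=
  closure (\bigcup_(k in [set: nat]) [set rauzy_proj w (ab R (iprefix w k))]).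
Arguments rauzy_fractal : clear implicits.

Definition line (R : realType) (p v : 'rV[R]_3) : set 'rV[R]_3 :=
  [set p + t *: v | t in [set: R]].

Definition between (R : realType) (L M : set 'rV[R]_3) : set 'rV[R]_3 :=
  [set x | exists p q : 'rV[R]_3, exists s : R,
    [/\ L p, M q, 0 <= s <= 1 & x = (1 - s) *: p + s *: q]].

(* [line p v] and [line q v] range over the pairs of parallel lines of the
   plane. *)
Definition unbounded_in_all_directions (R : realType)
    (S : set 'rV[R]_3) : Prop :=
  forall p q v : 'rV[R]_3,
    (p <= Delta0 R)%MS -> (q <= Delta0 R)%MS -> (v <= Delta0 R)%MS -> v != 0 ->
    ~ (S `<=` between (line p v) (line q v)).

(* Main.v *)
(* If the integer vector tau is a combination ab p1 + ab p2 - ab p3 - ab p4 of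
   prefixes p1, ..., p4 of w and tau lies in the plane, then tau is its own
   projection, so a strip containing the Rauzy fractal bounds tau transversally.
   Hence it is enough to build w so that every integer vector is such a
   combination.  When the substitution sigma_i is put in front, the
   combinations reach M_i tau + c e_i with |c| <= 2, since the image of a prefix
   may be extended by the letter i.  Conversely, undoing such moves, every
   integer vector descends to 0: one coordinate is replaced by itself minus the
   sum of the two others, up to c.  Two of the three pair sums have the same
   sign, and Euclid's algorithm on them leads to a vector (t, -b, b), where t is
   free; the corrections c then decrease b.  As the M_i are invertible, every
   finite directive sequence extends to one realizing a prescribed vector, so
   all vectors are realized successively; long powers of single substitutions
   inserted in between make the letter frequencies converge. *)
Require Import Defs.
From mathcomp Require Import all_boot all_order all_algebra.
From mathcomp Require Import all_classical all_reals all_analysis.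
From mathcomp Require Import zify ring lra.

Set Implicit Arguments.
Unset Strict Implicit.
Unset Printing Implicit Defensive.

Import Order.TTheory GRing.Theory Num.Theory.
Import numFieldNormedType.Exports.

Local Open Scope classical_set_scope.
Local Open Scope ring_scope.

(** * Reachability of integer vectors by elementary moves *)

(** The moves are [tau |-> M_i tau + c e_i]. An arbitrary [P] is used so that permuting its
    arguments reduces every case to one choice of coordinates. *)
Record move_closed (P : int -> int -> int -> Prop) : Prop := MoveClosed {
  closed0 : P 0 0 0;
  closed1 : forall x y z c, `|c| <= 2 -> P x y z -> P (x + y + z + c) y z;
  closed2 : forall x y z c, `|c| <= 2 -> P x y z -> P x (x + y + z + c) z;
  closed3 : forall x y z c, `|c| <= 2 -> P x y z -> P x y (x + y + z + c)
}.

Lemma move_closed_swap P :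
  move_closed P -> move_closed (fun x y z => P x z y).
Proof.
case=> P0 P1 P2 P3; split=> // x y z c c2 Pxyz; rewrite [x + y + z]addrAC; auto.
Qed.

Lemma move_closed_rot P :
  move_closed P -> move_closed (fun x y z => P z x y).
Proof.
case=> P0 P1 P2 P3; split=> // x y z c c2 Pxyz;
  (have -> : x + y + z = z + x + y by ring); auto.
Qed.

(** On [(t, -b, b)] the first move is [t |-> t + c], since the other two coordinates cancel. *)
Lemma move_closed_free P t t' b :
  move_closed P -> P t (- b) b -> P t' (- b) b.
Proof.
move=> [_ P1 _ _] Pt.
have up (n : nat) : P (t + n%:Z) (- b) b /\ P (t - n%:Z) (- b) b.
  elim: n => [|n [IHl IHr]]; first by split; have := Pt; congr P; lia.
  split.
    by have := P1 _ _ _ 1 isT IHl; congr P; lia.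
  by have := P1 _ _ _ (-1) isT IHr; congr P; lia.
have [lttt'|lett'] := leP t t'.
  by have [+ _] := up `|t' - t|%N; congr P; lia.
by have [_ +] := up `|t - t'|%N; congr P; lia.
Qed.

Lemma move_closed_opp_nat (n : nat) P t :
  move_closed P -> P t (- n%:Z) n%:Z.
Proof.
elim: n P t => [|n IHn] P t cP.
  by apply: (@move_closed_free P 0) => //; rewrite oppr0; case: cP.
apply: (@move_closed_free P n%:Z) => //.
(* In rotated coordinates the induction hypothesis reads [P n 0 (-n)], with the middle coordinate
   free. *)
have Py : P n%:Z (- n.+1%:Z) (- n%:Z).
  have cP' : move_closed (fun x y z => P z x y) := move_closed_rot cP.
  exact: (@move_closed_free _ 0 _ n%:Z cP' (IHn _ 0 cP')).
(* The first two coordinates sum to [-1], so a move with [c = 2] raises the third by exactly 1. *)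
have up (m : nat) : P n%:Z (- n.+1%:Z) (- n%:Z + m%:Z).
  elim: m => [|m IHm]; first by have := Py; congr P; lia.
  by have := closed3 cP (c := 2) isT IHm; congr P; lia.
by have := up (n + n.+1)%N; congr P; lia.
Qed.

Lemma move_closed_opp P t b : move_closed P -> P t (- b) b.
Proof.
move=> cP; case: (leP 0 b) => b0.
  by have := move_closed_opp_nat `|b|%N t cP; congr P; lia.
by have := move_closed_opp_nat `|b|%N t (move_closed_swap cP); congr P; lia.
Qed.

(* Changing [x] subtracts [y + z] from [x + y], changing [z] subtracts [x + y]
   from [y + z]: this is the subtractive Euclidean algorithm. *)
Lemma move_closed_euclid P (x y z : int) :
  move_closed P -> 0 <= (x + y) * (y + z) -> P x y z.
Proof.
move=> cP.
have [n] : exists n : nat, `|x + y| + `|y + z| <= n%:Z.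
  by exists (`|(x + y)%R| + `|(y + z)%R|)%N; lia.
elim: n x y z => [|n IHn] x y z.
  move=> ? _; have -> : y = - z by lia.
  exact: move_closed_opp.
move=> le_n ge0.
have [yz0|yz0] := eqVneq (y + z) 0.
  have -> : y = - z by lia.
  exact: move_closed_opp.
have [xy0|xy0] := eqVneq (x + y) 0.
  have -> : x = - y by lia.
  exact: (move_closed_opp z y (move_closed_rot (move_closed_rot cP))).
(* Both sums are nonzero of the same sign: subtracting the smaller in absolute value from the other
   keeps the product nonnegative and shrinks the measure. *)
have sgn : (0 < x + y) && (0 < y + z) || (x + y < 0) && (y + z < 0) by nia.
have [le_yz|lt_yz] := leP `|y + z| `|x + y|.
  have /(closed1 cP (c := 0) isT) : P (x - (y + z)) y z.
    by apply: IHn; [lia|nia].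
  by congr P; lia.
have /(closed3 cP (c := 0) isT) : P x y (z - (x + y)).
  by apply: IHn; [lia|nia].
by congr P; lia.
Qed.

Lemma move_closed_all P x y z : move_closed P -> P x y z.
Proof.
move=> cP.
have [?|xy_yz] := leP 0 ((x + y) * (y + z)); first exact: (move_closed_euclid cP).
have [?|yz_zx] := leP 0 ((y + z) * (z + x)).
  exact: (move_closed_euclid (x := y) (z := x) (move_closed_rot cP)).
have zx_xy : 0 <= (z + x) * (x + y).
  have [yz|yz] := leP 0 (y + z).
    have [? ?] : x + y < 0 /\ z + x < 0 by split; nia.
    nia.
  have [? ?] : 0 < x + y /\ 0 < z + x by split; nia.
  nia.
exact: (move_closed_euclid (x := z) (z := y) (move_closed_rot (move_closed_rot cP))).
Qed.

(** * Counts, prefixes and lengths under Arnoux-Rauzy substitutions *)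

(** Each [ar_letter i j] contains [i] exactly once. *)
Lemma count_ar_subst i a u :
  count_mem a (ar_subst i u) = if a == i then size u else count_mem a u.
Proof.
elim: u => [|j u IHu]; first by case: ifP.
rewrite /ar_subst /= count_cat -/(ar_subst i u) IHu /ar_letter.
have [->|ai] := eqVneq a i; have [ji|ji] := eqVneq j i => /=.
- by rewrite eqxx addn0.
- by rewrite eqxx (negPf ji) addn0.
- by rewrite ji addn0.
- by rewrite eq_sym (negPf ai) addn0.
Qed.

Lemma size_count_mem (T : finType) (u : seq T) :
  size u = (\sum_a count_mem a u)%N.
Proof.
elim: u => [|j u IHu] /=; first by rewrite big1.
rewrite big_split /= -IHu (bigD1 j) //= eqxx big1 // => a; rewrite eq_sym.
by move/negPf->.
Qed.

Lemma ar_subst_cat i u v : ar_subst i (u ++ v) = ar_subst i u ++ ar_subst i v.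
Proof. by rewrite /ar_subst map_cat flatten_cat. Qed.

(** Every image of a letter begins with [i], so whatever follows [ar_subst i u] on the right-hand
    side starts with [i]. *)
Lemma prefix_ar_subst i u v :
  prefix u v -> prefix (rcons (ar_subst i u) i) (rcons (ar_subst i v) i).
Proof.
case/prefixP=> x ->; have [r xr] : exists r, ar_subst i x ++ [:: i] = [:: i] ++ r.
  case: x => [|j x]; first by exists [::].
  by rewrite /ar_subst /= /ar_letter; case: ifP => _; eexists.
by rewrite ar_subst_cat -!cats1 -catA xr catA prefix_prefix.
Qed.

(* The longest word that begins [s_0 o ... o s_(n-1) (x)] for every infinite
   word [x]. *)
Definition ar_core (s : seq letter) : word :=
  foldr (fun i u => rcons (ar_subst i u) i) [::] s.

Definition ar_comp (s : seq letter) (u : word) : word := foldr ar_subst u s.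

Lemma ar_comp_cat s t u : ar_comp (s ++ t) u = ar_comp s (ar_comp t u).
Proof. exact: foldr_cat. Qed.

Lemma ar_comp_nil s : ar_comp s [::] = [::].
Proof. by elim: s => //= i s ->. Qed.

Lemma ar_comp_catr s u v : ar_comp s (u ++ v) = ar_comp s u ++ ar_comp s v.
Proof. by elim: s => //= i s ->; rewrite ar_subst_cat. Qed.

(** This cuts a long core into blocks [ar_comp s [:: j]], on which letter frequencies are
    controlled. *)
Lemma ar_core_cat s t : ar_core (s ++ t) = ar_comp s (ar_core t) ++ ar_core s.
Proof.
elim: s => [|i s IHs] /=; first by rewrite cats0.
by rewrite IHs ar_subst_cat rcons_cat.
Qed.

Lemma prefix_ar_core s t : prefix (ar_core s) (ar_core (s ++ t)).
Proof.
elim: s => [|i s IHs] /=; [exact: prefix0s|exact: prefix_ar_subst].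
Qed.

Lemma prefix_ar_core_comp s u : prefix (ar_core s) (ar_comp s u ++ ar_core s).
Proof.
elim: s => [|i s IHs] /=; first exact: prefix0s.
by rewrite -rcons_cat -ar_subst_cat; apply: prefix_ar_subst.
Qed.

Lemma leq_size_ar_subst i u : (size u <= size (ar_subst i u))%N.
Proof.
elim: u => //= j u IHu; rewrite /ar_subst /= size_cat -/(ar_subst i u).
by rewrite /ar_letter; case: ifP => _ /=; lia.
Qed.

Lemma leq_size_ar_comp s u : (size u <= size (ar_comp s u))%N.
Proof. by elim: s => //= i s IHs; apply: leq_trans (leq_size_ar_subst _ _). Qed.

Lemma leq_size_ar_core s : (size s <= size (ar_core s))%N.
Proof.
elim: s => //= i s IHs; rewrite size_rcons ltnS.
exact: leq_trans (leq_size_ar_subst _ _).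
Qed.

(** * Realizing integer vectors by prefixes of cores *)

(* Two prefixes would only allow [|c| <= 1] in [realized_cons], which is not
   enough for the descent in [move_closed_opp_nat]. *)
Definition realized (s : seq letter) (v : letter -> int) : Prop :=
  exists p1 p2 p3 p4 : word,
    [/\ prefix p1 (ar_core s), prefix p2 (ar_core s),
        prefix p3 (ar_core s), prefix p4 (ar_core s)
      & forall a, v a = (count_mem a p1)%:Z + (count_mem a p2)%:Z
                      - (count_mem a p3)%:Z - (count_mem a p4)%:Z].

Lemma eq_realized s v v' : v =1 v' -> realized s v -> realized s v'.
Proof.
move=> vv' [p1 [p2 [p3 [p4 [? ? ? ? pv]]]]]; exists p1, p2, p3, p4.
by split=> // a; rewrite -vv'.
Qed.

(** The image of a prefix, with or without a final [i], is a prefix of the new core. The four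
    optional letters contribute [b1 + b2 - b3 - b4], which takes every value from -2 to 2. *)
Lemma realized_cons i s v v' c : `|c| <= 2 ->
  (forall a, v' a = if a == i then \sum_j v j + c else v a) ->
  realized s v -> realized (i :: s) v'.
Proof.
move=> c2 v'E [p1 [p2 [p3 [p4 [pr1 pr2 pr3 pr4 pv]]]]].
pose f (b : bool) p := if b then rcons (ar_subst i p) i else ar_subst i p.
have prf b p : prefix p (ar_core s) -> prefix (f b p) (ar_core (i :: s)).
  move=> /(prefix_ar_subst i); rewrite /f; case: b => //=.
  by apply: prefix_trans; apply: prefix_rcons.
have cf b p a : count_mem a (f b p) =
    if a == i then (size p + b)%N else count_mem a p.
  rewrite /f; case: b; rewrite -?cats1 ?count_cat count_ar_subst /= eq_sym;
  by case: eqP => _ /=; rewrite ?addn0.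
have [b1 [b2 [b3 [b4 cE]]]] : exists b1 b2 b3 b4 : bool,
    c = b1%:Z + b2%:Z - b3%:Z - b4%:Z.
  have [->|[->|[->|[->|->]]]] : c = 0 \/ c = 1 \/ c = 2 \/ c = -1 \/ c = -2 by lia.
  - by exists false, false, false, false.
  - by exists true, false, false, false.
  - by exists true, true, false, false.
  - by exists false, false, true, false.
  - by exists false, false, true, true.
exists (f b1 p1), (f b2 p2), (f b3 p3), (f b4 p4); split; try exact: prf.
move=> a; rewrite v'E !cf; case: ifP => _; last exact: pv.
have sizeZ p : (size p)%:Z = \sum_j (count_mem j p)%:Z.
  by rewrite size_count_mem; apply: (big_morph Posz PoszD (erefl _)).
rewrite cE (eq_bigr _ (fun j _ => pv j)) !sumrB big_split /= !PoszD !sizeZ.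
ring.
Qed.

Definition letter_fun (x y z : int) (a : letter) : int :=
  nth 0 [:: x; y; z] a.

Lemma ord3P (P : 'I_3 -> Prop) :
  P ord0 -> P (lift ord0 ord0) -> P ord_max -> forall a, P a.
Proof.
move=> P0 P1 P2 [[|[|[|//]]] ai]; [move: P0|move: P1|move: P2];
  by congr P; apply: val_inj.
Qed.

Lemma realized_all x y z : exists s, realized s (letter_fun x y z).
Proof.
pose P x y z := exists s, realized s (letter_fun x y z).
suff : move_closed P by apply: move_closed_all.
have step i x' y' z' x'' y'' z'' c : `|c| <= 2 ->
    (forall a, letter_fun x'' y'' z'' a =
       if a == i then x' + y' + z' + c else letter_fun x' y' z' a) ->
    P x' y' z' -> P x'' y'' z''.
  move=> c2 Pv [s sv]; exists (i :: s); apply: realized_cons c2 _ sv => a.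
  by rewrite Pv !big_ord_recl big_ord0 addr0 !addrA.
split.
- exists [::], [::], [::], [::], [::]; split=> //.
  by apply: ord3P.
- by move=> x' y' z' c c2; apply: (step ord0 _ _ _ _ _ _ c) => //; apply: ord3P.
- by move=> x' y' z' c c2; apply: (step (lift ord0 ord0) _ _ _ _ _ _ c) => //;
    apply: ord3P.
- by move=> x' y' z' c c2; apply: (step ord_max _ _ _ _ _ _ c) => //; apply: ord3P.
Qed.

Lemma realized_cat s v : exists t, realized (s ++ t) v.
Proof.
elim: s v => [|i s IHs] v.
  have [t tv] := realized_all (v ord0) (v (lift ord0 ord0)) (v ord_max).
  by exists t; apply: eq_realized tv; apply: ord3P.
(* This is the preimage of [v] under the matrix of [sigma_i], which is invertible over the
   integers. *)
pose v' a := if a == i then v i *+ 2 - \sum_j v j else v a.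
have [t tv'] := IHs v'; exists t; apply: (realized_cons (c := 0)) tv' => // a.
case: eqVneq => [->|/negPf ai]; last by rewrite /v' ai.
rewrite addr0 (bigD1 i) //= (eq_bigr v) => [|j /negPf ji]; last by rewrite /v' ji.
rewrite /v' eqxx [\sum_j v j](bigD1 i) //=.
ring.
Qed.

Lemma realized_catr s t v : realized s v -> realized (s ++ t) v.
Proof.
move=> [p1 [p2 [p3 [p4 [pr1 pr2 pr3 pr4 pv]]]]]; exists p1, p2, p3, p4.
by split=> //; apply: prefix_trans (prefix_ar_core s t).
Qed.

(** * Discrepancies and approximate letter frequencies *)

(** Unlike the ratio of letters, this quantity is additive under concatenation. *)
Definition discrepancy (R : realType) (a : letter) (r : R) (u : word) : R :=
  (count_mem a u)%:R - r * (size u)%:R.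

Lemma discrepancy_cat (R : realType) a (r : R) u v :
  discrepancy a r (u ++ v) = discrepancy a r u + discrepancy a r v.
Proof. rewrite /discrepancy count_cat size_cat !natrD; ring. Qed.

Lemma normr_discrepancy_le (R : realType) a (r : R) u :
  0 <= r <= 1 -> `|discrepancy a r u| <= (size u)%:R.
Proof.
move=> /andP[r0 r1]; have := count_size (pred1 a) u; rewrite -(ler_nat R) => c1.
have c0 : 0 <= (count_mem a u)%:R :> R by [].
rewrite ler_norml /discrepancy; apply/andP; split; nra.
Qed.

(* [r] approximates the proportion of [a] in [ar_comp s u] up to [1 / n.+1], for
   every [u]. *)
Definition freq_close (R : realType) (s : seq letter) (n : nat) : Prop :=
  forall a : letter, exists2 r : R, 0 <= r <= 1 &
    forall j : letter, `|discrepancy a r (ar_comp s [:: j])| * n.+1%:R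
                       <= (size (ar_comp s [:: j]))%:R.

Lemma ar_subst_nseq i k : ar_subst i (nseq k i) = nseq k i.
Proof.
by elim: k => //= k IHk; rewrite /ar_subst /= -/(ar_subst i _) IHk /ar_letter eqxx.
Qed.

Lemma ar_comp_nseq k i j :
  ar_comp (nseq k i) [:: j] = if j == i then [:: i] else nseq k i ++ [:: j].
Proof.
elim: k => [|k /= ->]; first by case: eqP => [->|].
case: ifP => ji; first exact: (ar_subst_nseq i 1).
rewrite ar_subst_cat ar_subst_nseq /ar_subst /= /ar_letter ji.
by rewrite (_ : [:: i; j] = nseq 1 i ++ [:: j]) // cats0 catA -nseqD addn1.
Qed.

(* With [r] the ratio of [a] in [ar_comp s [:: i]], appending [i ^ k] to [s]
   multiplies lengths by about [k] and leaves discrepancies bounded. *)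
Lemma freq_close_power (R : realType) s i n :
  exists k, freq_close R (s ++ nseq k.+1 i) n.
Proof.
pose h j := size (ar_comp s [:: j]).
have h_gt0 j : (0 < h j)%N := leq_size_ar_comp s [:: j].
(* The blocks of [i] have discrepancy 0, so only the last block counts, with at most [h j]; this [k]
   makes the total length at least [n.+1 * h j] for all [j]. *)
pose k := (n.+1 * \sum_j h j)%N.
have le_hk j : (n.+1 * h j <= k)%N by rewrite leq_mul2l (bigD1 j) //= leq_addr.
exists k => a.
pose r : R := (count_mem a (ar_comp s [:: i]))%:R / (h i)%:R.
have hi0 : 0 < (h i)%:R :> R by rewrite ltr0n.
have r01 : 0 <= r <= 1.
  by rewrite divr_ge0 //= ler_pdivrMr // mul1r ler_nat count_size.
have ri : discrepancy a r (ar_comp s [:: i]) = 0.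
  by rewrite /discrepancy divfK ?subrr // gt_eqF.
exists r => // j; rewrite ar_comp_cat ar_comp_nseq.
case: ifP => _; first by rewrite ri normr0 mul0r.
have pow m : discrepancy a r (ar_comp s (nseq m i)) = 0 /\
    (m <= size (ar_comp s (nseq m i)))%N.
  split; last by rewrite -{1}(size_nseq m i) leq_size_ar_comp.
  elim: m => [|m IHm].
    by rewrite ar_comp_nil /discrepancy mulr0 subrr.
  by rewrite -[nseq _ _]/([:: i] ++ nseq m i) ar_comp_catr discrepancy_cat ri IHm addr0.
have [dk sk] := pow k.+1.
rewrite ar_comp_catr discrepancy_cat dk add0r size_cat.
apply: le_trans (_ : (h j)%:R * n.+1%:R <= _).
  by rewrite ler_wpM2r // normr_discrepancy_le.
by rewrite -natrM ler_nat mulnC; have := le_hk j; lia.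
Qed.

(** * The directive sequence and its limit word *)

Lemma prefix_limit (T : Type) (x0 : T) (S : nat -> seq T) :
  (forall n, exists t, S n.+1 = S n ++ t) -> (forall n, (n <= size (S n))%N) ->
  exists f : nat -> T, forall n, mkseq f (size (S n)) = S n.
Proof.
(* Index [k] lies inside [S k.+1], so the default [x0] is never read. *)
move=> preS sizeS; exists (fun k => nth x0 (S k.+1) k) => n.
have mono m p : exists t, S (m + p)%N = S m ++ t.
  elim: p => [|p [t IHp]]; first by exists [::]; rewrite addn0 cats0.
  by have [t' St'] := preS (m + p)%N; exists (t ++ t'); rewrite addnS St' IHp catA.
apply: (@eq_from_nth _ x0); rewrite size_mkseq // => k kn.
rewrite nth_mkseq //; have kS := sizeS k.+1.
(* [S n] and [S k.+1] are compared inside [S (n + k.+1)], of which both are prefixes. *)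
have [t] := mono n k.+1; have [t'] := mono k.+1 n.
rewrite addnC => -> /(congr1 (fun u => nth x0 u k)).
by rewrite !nth_cat kn kS.
Qed.

Lemma mkseq_cat (T : Type) (f : nat -> T) m n :
  mkseq f (m + n) = mkseq f m ++ mkseq (fun k => f (m + k)%N) n.
Proof.
rewrite /mkseq iotaD map_cat; congr (_ ++ _); rewrite add0n.
by rewrite -[m in iota m]addn0 iotaDl -map_comp.
Qed.

Definition next_stage (R : realType) (v : nat -> letter -> int) n
    (s s' : seq letter) : Prop :=
  [/\ exists t, s' = s ++ t, (size s < size s')%N,
    last ord0 s' = inord (n %% 3), realized s' (v n) & freq_close R s' n].

Lemma next_stage_exists (R : realType) v n s : exists s', next_stage R v n s s'.
Proof.
have [t tv] := realized_cat s (v n).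
have [k fk] := freq_close_power R (s ++ t) (inord (n %% 3)) n.
(* The vector is realized first and survives the appended power, which supplies both the last letter
   and the frequency estimate. *)
exists ((s ++ t) ++ nseq k.+1 (inord (n %% 3))); split=> //.
- by rewrite -catA; eexists.
- by rewrite !size_cat size_nseq; lia.
- by rewrite last_cat; elim: k {fk}.
- exact: realized_catr.
Qed.

Lemma directive_exists (R : realType) (v : nat -> letter -> int) :
  exists d : nat -> letter,
    [/\ forall i, infinite_set [set n | d n = i],
        forall n, exists m, realized (mkseq d m) (v n)
      & forall n, exists m, freq_close R (mkseq d m) n].
Proof.
pose next n := projT1 (choice (next_stage_exists R v n)).
have nextP n s : next_stage R v n s (next n s) :=
  projT2 (choice (next_stage_exists R v n)) s.
pose S := fix S n := if n is n'.+1 then next n' (S n') else [::].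
have SS n : S n.+1 = next n (S n) by [].
have sizeS n : (n <= size (S n))%N.
  elim: n => // n IHn; have [_ + _ _ _] := nextP n (S n); exact: leq_ltn_trans.
have [|d dS] := prefix_limit ord0 _ sizeS.
  by move=> n; have [+ _ _ _ _] := nextP n (S n).
exists d; split=> [i fin_i|n|n].
- have [m mi] : exists m, forall n, d n = i -> (n < m)%N.
    have /finite_seqP[r rE] := fin_i.
    exists (\max_(n <- r) n).+1 => n dn; rewrite ltnS.
    apply: (leq_bigmax_seq (F := id)) => //.
    by have : [set n | d n = i] n := dn; rewrite rE.
  (* Stage [n] ends with the letter [i], at a position of [d] that is at least [n], hence at least
     [m]. *)
  pose n := (m * 3 + i)%N.
  have [_ _ + _ _] := nextP n (S n); rewrite -SS -dS.
  have := sizeS n.+1; case: (size (S n.+1)) => // k nk.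
  rewrite -[k.+1]addn1 mkseq_cat last_cat /= addn0 modnMDl modn_small // inord_val.
  by move=> /mi; move: nk; rewrite /n; lia.
- exists (size (S n.+1)); rewrite dS SS.
  by have [_ _ _ + _] := nextP n (S n).
- exists (size (S n.+1)); rewrite dS SS.
  by have [_ _ _ _ +] := nextP n (S n).
Qed.

Definition ar_limit (d : nat -> letter) (w : iword) : Prop :=
  forall n, mkseq w (size (ar_core (mkseq d n))) = ar_core (mkseq d n).

Lemma ar_limit_exists (d : nat -> letter) : exists w, ar_limit d w.
Proof.
apply: (prefix_limit ord0) => n; last first.
  by rewrite -{1}(size_mkseq d n) leq_size_ar_core.
rewrite -[n.+1]addn1 mkseq_cat.
have /prefixP[t ->] := prefix_ar_core (mkseq d n) [:: d (n + 0)%N].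
by exists t.
Qed.

(** * Convergence of the iterated substitutions to the limit word *)

Lemma infinite_nat_ge (A : set nat) m :
  infinite_set A -> exists2 n, (m <= n)%N & A n.
Proof.
move=> infA; apply: contrapT => Am; apply: infA.
apply: (@sub_finite_set _ _ `I_m); last exact: finite_II.
by move=> n An /=; rewrite ltnNge; apply/negP => mn; apply: Am; exists n.
Qed.

(** Hence the length of the iterates never decreases, and it grows strictly whenever [d n] differs
    from [a]. *)
Lemma ar_iterS d n a : ar_iter d n.+1 a =
  ar_comp (mkseq d n) (if a == d n then [::] else [:: d n]) ++ ar_iter d n a.
Proof.
rewrite /ar_iter -!/(ar_comp _ _) -ar_comp_catr -[n.+1]addn1 mkseq_cat ar_comp_cat.
rewrite /= addn0 /ar_subst /= /ar_letter cats0; congr ar_comp.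
by case: eqP => [->|].
Qed.

Lemma size_ar_iter_large d a N : (forall i, infinite_set [set n | d n = i]) ->
  exists m, forall n, (m <= n)%N -> (N <= size (ar_iter d n a))%N.
Proof.
move=> infd; elim: N => [|N [m IHN]]; first by exists 0%N.
pose b : letter := if a == ord0 then ord_max else ord0.
have ab : a != b by rewrite /b; case: (eqVneq a ord0) => [->|].
have [n mn dn] := infinite_nat_ge m (infd b).
exists n.+1; elim=> // p IHp; rewrite ltnS leq_eqVlt ar_iterS size_cat.
case/orP=> [/eqP <-|/IHp]; last by lia.
rewrite dn (negPf ab); have := leq_size_ar_comp (mkseq d n) [:: b].
by have := IHN _ mn; rewrite /=; lia.
Qed.

Lemma iword_dist_le (R : realType) (x y : iword) N :
  (forall k, (k < N)%N -> x k = y k) -> `|iword_dist R x y| <= 2 ^- N.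
Proof.
move=> xy; rewrite /iword_dist; case: pselect => [neq|_].
  case: ex_minnP => m xym _; rewrite ger0_norm ?invr_ge0 ?exprn_ge0 //.
  rewrite lef_pV2 ?posrE ?exprn_gt0 // ler_weXn2l ?ler1n // leqNgt.
  by apply/negP => /xy xym'; rewrite xym' eqxx in xym.
by rewrite normr0 invr_ge0 exprn_ge0.
Qed.

Lemma nth_ar_core d w n k : ar_limit d w -> (k < size (ar_core (mkseq d n)))%N ->
  nth ord0 (ar_core (mkseq d n)) k = w k.
Proof. by move=> wd kn; rewrite -wd nth_mkseq. Qed.

(** The iterate and the core need not be nested in a known order; they are compared inside the
    iterate followed by the core, which has the core as a prefix. *)
Lemma nth_ar_iter d w n a k : ar_limit d w -> (k < n)%N ->
  (k < size (ar_iter d n a))%N -> nth ord0 (ar_iter d n a) k = w k.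
Proof.
move=> wd kn ka; have kL : (k < size (ar_core (mkseq d n)))%N.
  by apply: leq_trans kn _; rewrite -{1}(size_mkseq d n) leq_size_ar_core.
rewrite -(nth_ar_core wd kL).
have /prefixP[t /(congr1 (fun u => nth ord0 u k))] :=
  prefix_ar_core_comp (mkseq d n) [:: a].
by rewrite !nth_cat ka kL.
Qed.

Lemma words_cvg_ar_iter (R : realType) d w a :
  (forall i, infinite_set [set n | d n = i]) -> ar_limit d w ->
  words_cvg R (fun n => ar_iter d n a) w.
Proof.
move=> infd wd v; apply/cvgrPdist_le => e e0; rewrite /=.
have [N Ne] : exists N : nat, 2 ^- N <= e :> R.
  exists (Num.truncn e^-1).+1; rewrite -[e]invrK lef_pV2 ?posrE ?invr_gt0 ?exprn_gt0 //.
  rewrite invrK (le_trans (ltW (truncnS_gt _))) // -natrX ler_nat ltnW //.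
  exact: ltn_expl.
have [m mP] := size_ar_iter_large a N infd.
near=> n; rewrite sub0r normrN; apply: le_trans Ne; apply: iword_dist_le => k kN.
have kn : (k < size (ar_iter d n a))%N.
  by apply: leq_trans kN _; apply: mP; near: n; exists m.
rewrite /cat_iword kn (nth_ar_iter wd) //.
by apply: leq_trans kN _; near: n; exists N.
Unshelve. all: by end_near. Qed.

(** * Existence of the letter frequencies *)

(** Complete blocks cost at most [e] per letter; the one block that is cut costs at most its length,
    which the final sum bounds. *)
Lemma discrepancy_take (R : realType) a (r e : R) s u k :
  0 <= r <= 1 -> 0 <= e ->
  (forall j, `|discrepancy a r (ar_comp s [:: j])| <= e * (size (ar_comp s [:: j]))%:R) ->
  `|discrepancy a r (take k (ar_comp s u))| <=
    e * k%:R + (\sum_j size (ar_comp s [:: j]))%:R.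
Proof.
move=> r01 e0 hs; elim: u k => [|j u IHu] k.
  by rewrite ar_comp_nil /discrepancy /= mulr0 subrr normr0 addr_ge0 ?mulr_ge0.
rewrite -cat1s ar_comp_catr take_cat; case: ltnP => kj.
  apply: le_trans (normr_discrepancy_le _ _ r01) _.
  rewrite -[leLHS]add0r lerD ?mulr_ge0 // ler_nat size_take kj (bigD1 j) //=.
  exact: leq_trans (ltnW kj) (leq_addr _ _).
rewrite discrepancy_cat; apply: le_trans (ler_normD _ _) _.
apply: le_trans (lerD (hs j) (IHu _)) _.
by rewrite addrA -mulrDr -natrD subnKC.
Qed.

Lemma ar_limit_take d w m k : ar_limit d w ->
  exists u, mkseq w k = take k (ar_comp (mkseq d m) u).
Proof.
(* At level [m + k] the inner core has at least [k] letters, so the prefix of length [k] ends inside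
   its image. *)
move=> wd; have := wd (m + k); rewrite mkseq_cat ar_core_cat.
set u := ar_core (mkseq _ k) => uE; exists u.
have ku : (k <= size (ar_comp (mkseq d m) u))%N.
  apply: leq_trans (leq_size_ar_comp _ _).
  rewrite -{1}(size_mkseq (fun p => d (m + p)%N) k).
  exact: leq_size_ar_core.
move/(congr1 (take k)): uE; rewrite takel_cat // => <-.
rewrite size_cat -(subnKC (leq_trans ku (leq_addr (size (ar_core (mkseq d m))) _))).
by rewrite mkseq_cat take_size_cat ?size_mkseq.
Qed.

(** The [r] given by [freq_close] depends on [n], so the Cauchy criterion is used: all far ratios
    lie within [1 / n.+1 + H / k] of [r]. *)
Lemma has_letter_freq_of_freq_close (R : realType) d w : ar_limit d w ->
  (forall n, exists m, freq_close R (mkseq d m) n) -> has_letter_freq R w.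
Proof.
move=> wd fc a; apply/cauchy_cvgP/cauchy_exP => e e0.
have [n ne] : exists n : nat, n.+1%:R^-1 < e / 2.
  exists (Num.truncn (e / 2)^-1).
  by rewrite invf_plt ?posrE ?divr_gt0 // truncnS_gt.
have [m /(_ a)[r r01 hr]] := fc n; exists r.
pose H : R := (\sum_j size (ar_comp (mkseq d m) [:: j]))%:R.
have [K KH] : exists K : nat, H < K%:R * (e / 2).
  exists (Num.truncn (H / (e / 2))).+1.
  by rewrite -ltr_pdivrMr ?divr_gt0 // truncnS_gt.
exists K.+1 => // k /= Kk; rewrite /ball /= /letter_ratio.
have k0 : 0 < k%:R :> R by rewrite ltr0n; case: k Kk.
have [u uE] := ar_limit_take m k wd.
have : `|discrepancy a r (mkseq w k)| <= n.+1%:R^-1 * k%:R + H.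
  rewrite uE; apply: discrepancy_take => // j.
  by rewrite mulrC ler_pdivlMr.
rewrite /discrepancy size_mkseq => hk.
have -> : r - (count_mem a (iprefix w k))%:R / k%:R =
    - (((count_mem a (iprefix w k))%:R - r * k%:R) / k%:R).
  by field; rewrite gt_eqF.
rewrite normrN normrM [`|k%:R^-1|]gtr0_norm ?invr_gt0 // ltr_pdivrMr //.
apply: le_lt_trans hk _; rewrite (splitr e) mulrDl ltrD ?ltr_pM2r //.
by apply: lt_trans KH _; rewrite mulrC ltr_pM2l ?divr_gt0 // ltr_nat.
Qed.

(** * Projection onto the plane and unboundedness of the fractal *)

Lemma sum_letter_freq (R : realType) (w : iword) :
  has_letter_freq R w -> \sum_a letter_freq R w 0 a = 1.
Proof.
move=> fw.
have cv : (fun n => \sum_a letter_ratio R w a n) @ \oo --> \sum_a letter_freq R w 0 a.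
  apply: cvg_big => [|a _]; first exact: add_continuous.
  by rewrite mxE; apply: fw.
(* The ratios sum to 1 only from index 1 on: at index 0 each is [0 / 0 = 0]. *)
apply: (cvg_unique _ cv) => //; apply: cvg_near_cst; exists 1%N => // n /= n0.
rewrite -mulr_suml -natr_sum -size_count_mem size_mkseq divff //.
by rewrite pnatr_eq0 -lt0n.
Qed.

Lemma rauzy_proj_sub (R : realType) (w : iword) (x : 'rV[R]_3) :
  (rauzy_proj w x <= Delta0 R)%MS.
Proof. exact: proj_mx_sub. Qed.

(** The frequencies sum to 1, so their line meets the plane only at 0. *)
Lemma rauzy_proj_id (R : realType) (w : iword) (x : 'rV[R]_3) :
  has_letter_freq R w -> (x <= Delta0 R)%MS -> rauzy_proj w x = x.
Proof.
move=> /sum_letter_freq f1 xD; apply: proj_mx_id => //.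
apply/eqP; rewrite -submx0; apply/row_subP => i.
have : (row i (Delta0 R :&: <<letter_freq R w>>) <= Delta0 R :&: <<letter_freq R w>>)%MS.
  exact: row_sub.
rewrite sub_capmx genmxE => /andP[rD /sub_rVP[c rc]].
move: rD; rewrite rc => /Delta0P.
have -> : \sum_j (c *: letter_freq R w) 0 j = c.
  by rewrite -[RHS]mulr1 -f1 mulr_sumr; apply: eq_bigr => j _; rewrite mxE.
move=> ->.
by rewrite scale0r sub0mx.
Qed.

Lemma closed_Delta0 (R : realType) : closed [set x : 'rV[R]_3 | (x <= Delta0 R)%MS].
Proof.
have -> : [set x : 'rV[R]_3 | (x <= Delta0 R)%MS] =
    (fun x : 'rV[R]_3 => \sum_i x 0 i) @^-1` [set 0].
  by apply/seteqP; split=> x /Delta0P.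
apply: preimage_closed; last exact: closed_eq.
move=> x _; apply: continuous_big => [|i _]; first exact: add_continuous.
exact: coord_continuous.
Qed.

Lemma rauzy_fractal_sub (R : realType) (w : iword) :
  rauzy_fractal R w `<=` [set x | (x <= Delta0 R)%MS].
Proof.
rewrite [X in _ `<=` X](closure_id _).1; last exact: closed_Delta0.
by apply: closureS => _ [k _ ->]; apply: rauzy_proj_sub.
Qed.

Definition intvec (R : realType) (v : letter -> int) : 'rV[R]_3 := \row_a (v a)%:~R.

(** The minor is a linear form in [x] that vanishes on [v], hence is constant on each of the two
    lines. *)
Lemma between_bounded (R : realType) (p q v x : 'rV[R]_3) i j :
  between (line p v) (line q v) x ->
  `|x 0 i * v 0 j - x 0 j * v 0 i| <=
    `|p 0 i * v 0 j - p 0 j * v 0 i| + `|q 0 i * v 0 j - q 0 j * v 0 i|.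
Proof.
move=> [_ [_ [s [[t _ <-] [t' _ <-] /andP[s0 s1] ->]]]]; rewrite !mxE.
set a := p 0 i * _ - _; set b := q 0 i * _ - _.
rewrite [X in `|X|](_ : _ = (1 - s) * a + s * b); last by rewrite /a /b; ring.
apply: le_trans (ler_normD _ _) _; rewrite !normrM lerD //.
  by rewrite ler_piMl // ger0_norm ?subr_ge0 // gerBl.
by rewrite ler_piMl // ger0_norm.
Qed.

Lemma unbounded_rauzy_fractal (R : realType) (w : iword) : has_letter_freq R w ->
  (forall x y z, exists k1 k2 k3 k4, forall a, letter_fun x y z a =
      (count_mem a (mkseq w k1))%:Z + (count_mem a (mkseq w k2))%:Z
      - (count_mem a (mkseq w k3))%:Z - (count_mem a (mkseq w k4))%:Z) ->
  unbounded_in_all_directions (rauzy_fractal R w).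
Proof.
move=> fw wP p q v _ _ vD v0 Rw.
pose i := ord0 : 'I_3; pose j := lift ord0 ord0 : 'I_3.
have [B bounded] : exists B : R, forall x y z, x + y + z = 0 ->
    `|(letter_fun x y z i)%:~R * v 0 j - (letter_fun x y z j)%:~R * v 0 i| <= B.
  pose l (x : 'rV[R]_3) := x 0 i * v 0 j - x 0 j * v 0 i.
  (* An integer vector of the plane is its own projection, hence a signed sum of four points of the
     fractal. *)
  exists ((`|l p| + `|l q|) *+ 4) => x y z xyz.
  have lw k : `|l (rauzy_proj w (ab R (mkseq w k)))| <= `|l p| + `|l q|.
    by apply: between_bounded; apply: Rw; apply: subset_closure; exists k.
  have [k1 [k2 [k3 [k4 kP]]]] := wP x y z.
  pose g k := ab R (mkseq w k).
  have tE : intvec R (letter_fun x y z) = g k1 + g k2 - g k3 - g k4.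
    apply/rowP => a; rewrite !mxE kP.
    by rewrite !rmorphB rmorphD.
  have tD : (intvec R (letter_fun x y z) <= Delta0 R)%MS.
    apply/Delta0P; rewrite !big_ord_recl big_ord0 !mxE /= addr0 -!rmorphD /=.
    by rewrite addrA xyz.
  have := rauzy_proj_id fw tD.
  rewrite {1}tE /rauzy_proj !mulmxBl mulmxDl -!/(rauzy_proj w _) => E.
  have -> : (letter_fun x y z i)%:~R * v 0 j - (letter_fun x y z j)%:~R * v 0 i =
     l (rauzy_proj w (g k1)) + l (rauzy_proj w (g k2))
     - l (rauzy_proj w (g k3)) - l (rauzy_proj w (g k4)).
    have tv a : (letter_fun x y z a)%:~R = intvec R (letter_fun x y z) 0 a.
      by rewrite mxE.
    rewrite !tv -E; move: (rauzy_proj w (g k1)) (rauzy_proj w (g k2)).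
    move: (rauzy_proj w (g k3)) (rauzy_proj w (g k4)) => ? ? ? ?.
    by rewrite /l !mxE; ring.
  have := (lw k1, lw k2, lw k3, lw k4); rewrite -!/(g _).
  set l1 := l _; set l2 := l _; set l3 := l _; set l4 := l _ => -[[[]]].
  by rewrite !ler_norml => /andP[? ?] /andP[? ?] /andP[? ?] /andP[? ?]; lra.
have zero t : (forall n : nat, `|n%:R * t| <= B) -> t = 0.
  move=> tB; apply/eqP; apply: contraT; rewrite -normr_gt0 => t0.
  have := tB (Num.truncn (B / `|t|)).+1.
  by rewrite normrM normr_nat leNgt -ltr_pdivrMr // truncnS_gt.
(* The bound on all multiples of [(1, 0, -1)] and [(0, 1, -1)] kills two coordinates of [v]; the
   plane equation kills the third. *)
have vj : v 0 j = 0.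
  apply: zero => n; have := bounded n%:Z 0 (- n%:Z).
  by rewrite addr0 subrr => /(_ erefl); rewrite /= mul0r subr0.
have vi : v 0 i = 0.
  apply: zero => n; have := bounded 0 n%:Z (- n%:Z).
  by rewrite add0r subrr => /(_ erefl); rewrite /= mul0r sub0r normrN.
have /Delta0P := vD; rewrite !big_ord_recl big_ord0 vi vj !add0r addr0 => vk.
case/eqP: v0; apply/rowP => a; rewrite mxE; move: a; apply: ord3P => //.
by rewrite -[RHS]vk; congr (v 0 _); apply: val_inj.
Qed.

Theorem theorem1 (R : realType) :
  exists w : iword,
    [/\ arnoux_rauzy R w,
        has_letter_freq R w,
        rauzy_fractal R w `<=` [set x | (x <= Delta0 R)%MS]
      & unbounded_in_all_directions (rauzy_fractal R w)].
Proof.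
(* This enumerates all integer triples; a number that codes no triple is given the zero vector. *)
pose v n := if unpickle n is Some (x, y, z) then letter_fun x y z else fun=> 0.
have [d [infd dv dfreq]] := directive_exists R v.
have [w wd] := ar_limit_exists d.
have wfreq := has_letter_freq_of_freq_close wd dfreq.
exists w; split=> //.
- exists w; split=> //; exists d; split=> // a; exact: words_cvg_ar_iter.
- exact: rauzy_fractal_sub.
apply: unbounded_rauzy_fractal => // x y z.
have [m] := dv (pickle (x, y, z)); rewrite /v pickleK.
have toprefix p : prefix p (ar_core (mkseq d m)) -> exists k, p = mkseq w k.
  rewrite -wd => pw; exists (size p).
  move: pw (size_prefix pw) => /[swap]; rewrite size_mkseq prefixE => pL /eqP.
  by rewrite -{1}(subnKC pL) mkseq_cat take_size_cat ?size_mkseq.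
move=> [_ [_ [_ [_ [/toprefix[k1 ->] /toprefix[k2 ->]
  /toprefix[k3 ->] /toprefix[k4 ->]]]]]].
by exists k1, k2, k3, k4.
Qed.
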